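(* Let $\xi\in\mathbb{R}$, $\sigma\in\mathbb{R}\setminus\{0\}$, and let $F^\sigma_\xi(a,b)=\operatorname{sgn}(\sigma)\,(a^\xi+b^\xi)^{\sigma/\xi}$ if $\xi\neq 0$ and $F^\sigma_0(a,b)=\operatorname{sgn}(\sigma)\,(ab)^{\sigma/2}$ if $\xi=0$, for $a,b>0$. Suppose that $w$ is a maximum-principle function (MPF) for the normal velocity $F^\sigma_\xi$. (Contracting case.) Assume $\sigma>1$. Then: - if $\xi>0$, the constant $c>0$ in condition (5) of the definition of an MPF, for this $w$, is $c=1/\sigma$; - if $\xi=0$, then $\sigma\in(1,2]$; - the case $\xi<0$ is impossible, i.e. for $\xi<0$ and $\sigma>1$ there exists no MPF for $F^\sigma_\xi$. (Expanding case.) Assume $\sigma<0$. Then: - if $\xi>0$, then $\sigma\in[-1,0)$; - if $\xi=0$, then $\sigma\in[-2,0)$.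
   Context: Notation: $\mathbb{R}^2_+=(0,\infty)^2$; subscripts $a,b$ denote partial derivatives. Normal velocity: a symmetric function $F\in C^2(\mathbb{R}^2_+)$, homogeneous of some degree $\sigma\in\mathbb{R}\setminus\{0\}$, with $F_a,F_b>0$ for all $a,b>0$. It is contracting if $F>0$ everywhere on $\mathbb{R}^2_+$ and expanding if $F<0$ everywhere on $\mathbb{R}^2_+$. The function $F^\sigma_\xi$ is a normal velocity of degree $\sigma$, contracting if $\sigma>0$ and expanding if $\sigma<0$. Maximum-principle function (MPF) for a normal velocity $F$: a symmetric function $w\in C^2(\mathbb{R}^2_+)$, homogeneous of some degree $\chi\in\mathbb{R}\setminus\{0\}$, such that, with $\alpha=-w_a/w_b$ and $\alpha_a=\partial\alpha/\partial a$ (defined for $a\ne b$): (1) $w>0$ whenever $a\neq b$, and $w=0$ whenever $a=b$. (2) $\chi>0$ if $F$ is contracting, $\chi<0$ if $F$ is expanding. (3) $w_a<0$ for all $0<a<b$, and $w_a>0$ for all $0<b<a$. (4) For all $a,b>0$ (for $E_w,G_w$: $a\neq b$) one has $C_w(a,b)\le0$, $E_w(a,b)\le0$, $G_w(a,b)\le 0$, where $$C_w=w_a\,a\big((F_aa^2+F_bb^2)+(F-F_aa-F_bb)a\big)+w_b\,b\big((F_aa^2+F_bb^2)+(F-F_aa-F_bb)b\big),$$ $$E_w=w_a(F_{aa}+2F_{ab}\alpha+F_{bb}\alpha^2)-F_a(w_{aa}+2w_{ab}\alpha+w_{bb}\alpha^2)+2\,\frac{w_bF_a-w_aF_b}{a-b}\,\alpha^2,$$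 $$G_w=\frac1{\alpha^2}\Big(w_b(F_{aa}+2F_{ab}\alpha+F_{bb}\alpha^2)-F_b(w_{aa}+2w_{ab}\alpha+w_{bb}\alpha^2)+2\,\frac{w_bF_a-w_aF_b}{a-b}\Big).$$ (5) There are constants $c>0$, $d\in\mathbb{R}$ such that, evaluating $\alpha$ and $\alpha_a$ at $(a,b)=(\rho,1)$ with $0<\rho<1$: if $F$ is contracting, then either $\alpha=c$ and $\alpha_a=0$ for all sufficiently small $\rho$, or, as $\rho\to0$, $\alpha=\frac c\rho+o(\rho^{-1})$ and $\alpha_a=-\frac c{\rho^2}+o(\rho^{-1})$; if $F$ is expanding, then, as $\rho\to0$, either $\alpha=\frac c\rho+o(\rho^{-1})$ and $\alpha_a=-\frac c{\rho^2}+o(\rho^{-1})$, or $\alpha=\frac{c+d\rho}{\rho^2}+o(\rho^{-1})$ and $\alpha_a=-\frac{2c+d\rho}{\rho^3}+o(\rho^{-1})$. *)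

(* Defs.v *)
From Stdlib Require Import Reals Lra.
From Coquelicot Require Import Coquelicot.

Open Scope R_scope.

(* Functions on the open quadrant are total functions [R -> R -> R]; every
   condition below only involves them near points with positive coordinates. *)

Definition symmetric (f : R -> R -> R) : Prop :=
  forall a b, 0 < a -> 0 < b -> f a b = f b a.

Definition homogeneous (f : R -> R -> R) (m : R) : Prop :=
  forall l a b, 0 < l -> 0 < a -> 0 < b ->
    f (l * a) (l * b) = Rpower l m * f a b.

(* [ex_diff_n f 2 a b] asks that the partial derivatives of [f] of order at most
   2 exist and are jointly continuous at [(a, b)]; required at every point of the
   open quadrant, this is C^2 regularity there. *)
Definition C2 (f : R -> R -> R) : Prop :=
  forall a b, 0 < a -> 0 < b -> ex_diff_n f 2 a b.

Definition Da (f : R -> R -> R) (a b : R) : R := Derive (fun x => f x b) a.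
Definition Db (f : R -> R -> R) (a b : R) : R := Derive (fun y => f a y) b.
Definition Daa (f : R -> R -> R) : R -> R -> R := Da (Da f).
Definition Dab (f : R -> R -> R) : R -> R -> R := Db (Da f).
Definition Dbb (f : R -> R -> R) : R -> R -> R := Db (Db f).

Record normal_velocity : Type := NormalVelocity {
  nv_fun :> R -> R -> R;
  nv_deg : R;
  nv_sym : symmetric nv_fun;
  nv_C2 : C2 nv_fun;
  nv_deg_neq0 : nv_deg <> 0;
  nv_hom : homogeneous nv_fun nv_deg;
  nv_incr_a : forall a b, 0 < a -> 0 < b -> 0 < Da nv_fun a b;
  nv_incr_b : forall a b, 0 < a -> 0 < b -> 0 < Db nv_fun a b
}.

Definition contracting (F : normal_velocity) : Prop :=
  forall a b, 0 < a -> 0 < b -> 0 < F a b.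

Definition expanding (F : normal_velocity) : Prop :=
  forall a b, 0 < a -> 0 < b -> F a b < 0.

Definition alpha (w : R -> R -> R) (a b : R) : R := - (Da w a b / Db w a b).

Definition C_term (F w : R -> R -> R) (a b : R) : R :=
  Da w a b * a * ((Da F a b * a ^ 2 + Db F a b * b ^ 2)
                  + (F a b - Da F a b * a - Db F a b * b) * a)
  + Db w a b * b * ((Da F a b * a ^ 2 + Db F a b * b ^ 2)
                    + (F a b - Da F a b * a - Db F a b * b) * b).

(* The second derivative of [f] at [(a, b)] in the direction [(1, t)]. *)
Definition hess (f : R -> R -> R) (a b t : R) : R :=
  Daa f a b + 2 * Dab f a b * t + Dbb f a b * t ^ 2.

Definition E_term (F w : R -> R -> R) (a b : R) : R :=
  let al := alpha w a b in
  Da w a b * hess F a b al - Da F a b * hess w a b al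
  + 2 * ((Db w a b * Da F a b - Da w a b * Db F a b) / (a - b)) * al ^ 2.

Definition G_term (F w : R -> R -> R) (a b : R) : R :=
  let al := alpha w a b in
  1 / al ^ 2 *
  (Db w a b * hess F a b al - Db F a b * hess w a b al
   + 2 * ((Db w a b * Da F a b - Da w a b * Db F a b) / (a - b))).

(* [f rho = o(1 / rho)] as [rho] tends to 0 from the right. *)
Definition o_inv (f : R -> R) : Prop :=
  is_domin (at_right 0) (fun rho : R => / rho) f.

Definition asym_const (w : R -> R -> R) (c : R) : Prop :=
  at_right 0 (fun rho => alpha w rho 1 = c /\ Da (alpha w) rho 1 = 0).

Definition asym_pole1 (w : R -> R -> R) (c : R) : Prop :=
  o_inv (fun rho => alpha w rho 1 - c / rho) /\
  o_inv (fun rho => Da (alpha w) rho 1 - (- (c / rho ^ 2))).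

Definition asym_pole2 (w : R -> R -> R) (c d : R) : Prop :=
  o_inv (fun rho => alpha w rho 1 - (c + d * rho) / rho ^ 2) /\
  o_inv (fun rho => Da (alpha w) rho 1 - (- ((2 * c + d * rho) / rho ^ 3))).

Definition MPF_asymptotics (F : normal_velocity) (w : R -> R -> R) (c d : R) :
    Prop :=
  (contracting F -> asym_const w c \/ asym_pole1 w c) /\
  (expanding F -> asym_pole1 w c \/ asym_pole2 w c d).

Record is_MPF (F : normal_velocity) (w : R -> R -> R) : Prop := {
  mpf_sym : symmetric w;
  mpf_C2 : C2 w;
  mpf_hom : exists chi, chi <> 0 /\ homogeneous w chi /\
    (contracting F -> 0 < chi) /\ (expanding F -> chi < 0);
  mpf_pos : forall a b, 0 < a -> 0 < b -> a <> b -> 0 < w a b;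
  mpf_diag : forall a, 0 < a -> w a a = 0;
  mpf_decr : forall a b, 0 < a -> a < b -> Da w a b < 0;
  mpf_incr : forall a b, 0 < b -> b < a -> 0 < Da w a b;
  mpf_C : forall a b, 0 < a -> 0 < b -> C_term F w a b <= 0;
  mpf_E : forall a b, 0 < a -> 0 < b -> a <> b -> E_term F w a b <= 0;
  mpf_G : forall a b, 0 < a -> 0 < b -> a <> b -> G_term F w a b <= 0;
  mpf_asym : exists c d, 0 < c /\ MPF_asymptotics F w c d
}.

Definition Fxs (xi sigma a b : R) : R :=
  if Req_EM_T xi 0 then sign sigma * Rpower (a * b) (sigma / 2)
  else sign sigma * Rpower (Rpower a xi + Rpower b xi) (sigma / xi).

(* [Fxs xi sigma] is a combination of the following functions, a family whose
   linear span is closed under partial differentiation. *)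
Definition mono (xi k p q r a b : R) : R :=
  k * (Rpower a p * Rpower b q * Rpower (Rpower a xi + Rpower b xi) r).

Lemma Rpower_gt0 x p : 0 < Rpower x p.
Proof. apply exp_pos. Qed.

Lemma Rpower_sum_gt0 xi a b : 0 < Rpower a xi + Rpower b xi.
Proof. apply Rplus_lt_0_compat; apply Rpower_gt0. Qed.

Lemma is_derive_Rpower x p :
  0 < x -> is_derive (fun z => Rpower z p) x (p * Rpower x (p - 1)).
Proof. intros Hx; apply is_derive_Reals, derivable_pt_lim_power; exact Hx. Qed.

Lemma mono_sym xi k p q r a b : mono xi k p q r a b = mono xi k q p r b a.
Proof. unfold mono; rewrite (Rplus_comm (Rpower a xi)); ring. Qed.

Lemma is_derive_mono_a xi k p q r a b : 0 < a ->
  is_derive (fun x => mono xi k p q r x b) a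
    (mono xi (k * p) (p - 1) q r a b
     + mono xi (k * (r * xi)) (p + (xi - 1)) q (r - 1) a b).
Proof.
intros Ha.
assert (H1 : is_derive (fun x => Rpower x xi + Rpower b xi) a
               (xi * Rpower a (xi - 1) + 0)).
{ apply (is_derive_plus (V := R_NormedModule)).
  - now apply is_derive_Rpower.
  - apply (is_derive_const (V := R_NormedModule)). }
assert (H2 := is_derive_comp _ _ _ _ _
                (is_derive_Rpower _ r (Rpower_sum_gt0 xi a b)) H1).
assert (H3 := is_derive_mult _ _ _ _ _
                (is_derive_Rpower a p Ha) H2 Rmult_comm).
assert (H4 := is_derive_scal _ _ (k * Rpower b q) _ H3).
eapply is_derive_ext; [| evar_last; [exact H4 |]].
- intros t; unfold mono, mult; simpl; ring.
- unfold mono, mult, plus, scal; simpl; unfold mult; simpl.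
  rewrite (Rpower_plus p (xi - 1)); ring.
Qed.

Lemma is_derive_mono_b xi k p q r a b : 0 < b ->
  is_derive (fun y => mono xi k p q r a y) b
    (mono xi (k * q) p (q - 1) r a b
     + mono xi (k * (r * xi)) p (q + (xi - 1)) (r - 1) a b).
Proof.
intros Hb.
apply is_derive_ext with (fun y => mono xi k q p r y a).
- intros t; apply mono_sym.
- rewrite (mono_sym _ _ p (q - 1)), (mono_sym _ _ p (q + (xi - 1))).
  now apply is_derive_mono_a.
Qed.

Lemma locally_2d_quadrant (P : R -> R -> Prop) a b : 0 < a -> 0 < b ->
  (forall u v, 0 < u -> 0 < v -> P u v) -> locally_2d P a b.
Proof.
intros Ha Hb HP.
exists (mkposreal _ (Rmin_pos _ _ Ha Hb)); simpl; intros u v Hu Hv.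
apply Rabs_def2 in Hu; apply Rabs_def2 in Hv.
assert (H1 := Rmin_l a b); assert (H2 := Rmin_r a b).
apply HP; lra.
Qed.

Lemma continuity_2d_Rpower f p a b : 0 < f a b -> continuity_2d_pt f a b ->
  continuity_2d_pt (fun u v => Rpower (f u v) p) a b.
Proof.
intros Hf Cf; apply (continuity_1d_2d_pt_comp (fun z => Rpower z p)); auto.
apply derivable_continuous_pt.
exists (p * Rpower (f a b) (p - 1)); now apply derivable_pt_lim_power.
Qed.

Lemma continuity_2d_mono xi k p q r a b : 0 < a -> 0 < b ->
  continuity_2d_pt (mono xi k p q r) a b.
Proof.
intros Ha Hb; unfold mono.
assert (Ca : forall s, continuity_2d_pt (fun u _ : R => Rpower u s) a b).
{ intros s; apply (continuity_2d_Rpower (fun u _ => u)); auto.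
  apply continuity_2d_pt_id1. }
assert (Cb : forall s, continuity_2d_pt (fun _ v : R => Rpower v s) a b).
{ intros s; apply (continuity_2d_Rpower (fun _ v => v)); auto.
  apply continuity_2d_pt_id2. }
repeat apply continuity_2d_pt_mult; auto.
- apply continuity_2d_pt_const.
- apply (continuity_2d_Rpower (fun u v => Rpower u xi + Rpower v xi)).
  + apply Rpower_sum_gt0.
  + now apply continuity_2d_pt_plus.
Qed.

Lemma ex_diff_n_plus n : forall f g,
  (forall a b, 0 < a -> 0 < b -> ex_diff_n f n a b) ->
  (forall a b, 0 < a -> 0 < b -> ex_diff_n g n a b) ->
  forall a b, 0 < a -> 0 < b -> ex_diff_n (fun u v => f u v + g u v) n a b.
Proof.
induction n as [|n IH]; intros f g Hf Hg a b Ha Hb.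
- split; [|exact I].
  apply continuity_2d_pt_plus; [apply (Hf a b) | apply (Hg a b)]; auto.
- assert (ex : forall h u v, ex_diff_n h (S n) u v ->
            ex_derive (fun z => h z v) u /\ ex_derive (fun z => h u z) v)
    by (intros h u v H; split; apply H).
  split.
  { apply continuity_2d_pt_plus; [apply (Hf a b) | apply (Hg a b)]; auto. }
  split; [|split; [|split]].
  + apply (ex_derive_plus (V := R_NormedModule));
      [apply (Hf a b) | apply (Hg a b)]; auto.
  + apply (ex_derive_plus (V := R_NormedModule));
      [apply (Hf a b) | apply (Hg a b)]; auto.
  + apply ex_diff_n_ext_loc with (fun u v => Da f u v + Da g u v).
    * apply locally_2d_quadrant; auto; intros u v Hu Hv.
      unfold Da; rewrite Derive_plus; auto;
        [apply (ex f u v) | apply (ex g u v)]; auto.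
    * apply IH; auto; intros u v Hu Hv; [apply (Hf u v) | apply (Hg u v)]; auto.
  + apply ex_diff_n_ext_loc with (fun u v => Db f u v + Db g u v).
    * apply locally_2d_quadrant; auto; intros u v Hu Hv.
      unfold Db; rewrite Derive_plus; auto;
        [apply (ex f u v) | apply (ex g u v)]; auto.
    * apply IH; auto; intros u v Hu Hv; [apply (Hf u v) | apply (Hg u v)]; auto.
Qed.

Lemma ex_diff_n_mono xi n : forall k p q r a b, 0 < a -> 0 < b ->
  ex_diff_n (mono xi k p q r) n a b.
Proof.
induction n as [|n IH]; intros k p q r a b Ha Hb.
- split; [now apply continuity_2d_mono | exact I].
- split; [now apply continuity_2d_mono |].
  split; [eexists; now apply is_derive_mono_a |].
  split; [eexists; now apply is_derive_mono_b |].
  split.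
  + eapply ex_diff_n_ext_loc;
      [| apply ex_diff_n_plus; [intros; now apply IH | intros; now apply IH
                               | exact Ha | exact Hb]].
    apply locally_2d_quadrant; auto; intros u v Hu Hv.
    symmetry; apply is_derive_unique; now apply is_derive_mono_a.
  + eapply ex_diff_n_ext_loc;
      [| apply ex_diff_n_plus; [intros; now apply IH | intros; now apply IH
                               | exact Ha | exact Hb]].
    apply locally_2d_quadrant; auto; intros u v Hu Hv.
    symmetry; apply is_derive_unique; now apply is_derive_mono_b.
Qed.

Lemma Fxs_mono0 sigma a b : 0 < a -> 0 < b ->
  Fxs 0 sigma a b = mono 0 (sign sigma) (sigma / 2) (sigma / 2) 0 a b.
Proof.
intros Ha Hb; unfold Fxs, mono.
destruct (Req_EM_T 0 0) as [_|H]; [|now destruct H].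
rewrite Rpower_mult_distr, Rpower_O; auto; [ring | apply Rpower_sum_gt0].
Qed.

Lemma Fxs_mono xi sigma a b : xi <> 0 -> 0 < a -> 0 < b ->
  Fxs xi sigma a b = mono xi (sign sigma) 0 0 (sigma / xi) a b.
Proof.
intros Hxi Ha Hb; unfold Fxs, mono.
destruct (Req_EM_T xi 0) as [H|_]; [contradiction|].
rewrite !Rpower_O; auto; ring.
Qed.

Lemma Fxs_sym xi sigma : symmetric (Fxs xi sigma).
Proof.
intros a b _ _; unfold Fxs; destruct (Req_EM_T xi 0).
- now rewrite (Rmult_comm a).
- now rewrite (Rplus_comm (Rpower a xi)).
Qed.

Lemma Fxs_C2 xi sigma : C2 (Fxs xi sigma).
Proof.
intros a b Ha Hb; destruct (Req_EM_T xi 0) as [->|Hxi].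
- eapply ex_diff_n_ext_loc; [| now apply (ex_diff_n_mono 0 2)].
  apply locally_2d_quadrant; auto; intros u v Hu Hv; symmetry.
  now apply Fxs_mono0.
- eapply ex_diff_n_ext_loc; [| now apply (ex_diff_n_mono xi 2)].
  apply locally_2d_quadrant; auto; intros u v Hu Hv; symmetry.
  now apply Fxs_mono.
Qed.

Lemma Fxs_hom xi sigma : homogeneous (Fxs xi sigma) sigma.
Proof.
intros l a b Hl Ha Hb; unfold Fxs; destruct (Req_EM_T xi 0) as [_|Hxi].
- replace (l * a * (l * b)) with ((l * l) * (a * b)) by ring.
  rewrite <- !Rpower_mult_distr; auto using Rmult_lt_0_compat.
  rewrite <- Rpower_plus; replace (sigma / 2 + sigma / 2) with sigma by field.
  ring.
- rewrite <- !Rpower_mult_distr; auto.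
  replace (Rpower l xi * Rpower a xi + Rpower l xi * Rpower b xi)
    with (Rpower l xi * (Rpower a xi + Rpower b xi)) by ring.
  rewrite <- Rpower_mult_distr, Rpower_mult;
    [| apply Rpower_gt0 | apply Rpower_sum_gt0].
  replace (xi * (sigma / xi)) with sigma by (field; auto); ring.
Qed.

Lemma sign_mult_gt0 sigma : sigma <> 0 -> 0 < sign sigma * sigma.
Proof.
intros Hs; destruct (Rdichotomy _ _ Hs).
- rewrite sign_eq_m1; lra.
- rewrite sign_eq_1; lra.
Qed.

Lemma mono_gt0 xi k p q r a b : 0 < k -> 0 < mono xi k p q r a b.
Proof.
intros Hk; unfold mono.
repeat apply Rmult_lt_0_compat; auto using Rpower_gt0.
Qed.

Lemma Fxs_incr_a xi sigma : sigma <> 0 ->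
  forall a b, 0 < a -> 0 < b -> 0 < Da (Fxs xi sigma) a b.
Proof.
intros Hs a b Ha Hb; unfold Da; assert (Hk := sign_mult_gt0 sigma Hs).
assert (Hloc : forall f, (forall x, 0 < x -> f x = Fxs xi sigma x b) ->
          Derive (fun x => Fxs xi sigma x b) a = Derive f a).
{ intros f Hf; apply Derive_ext_loc.
  exists (mkposreal a Ha); intros x Hx.
  symmetry; apply Hf; apply Rabs_def2 in Hx; simpl in Hx.
  unfold minus, plus, opp in Hx; simpl in Hx; lra. }
destruct (Req_EM_T xi 0) as [->|Hxi].
- rewrite (Hloc (fun x => mono 0 (sign sigma) (sigma / 2) (sigma / 2) 0 x b))
    by (intros x Hx; symmetry; now apply Fxs_mono0).
  rewrite (is_derive_unique _ _ _ (is_derive_mono_a _ _ _ _ _ _ _ Ha)).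
  apply Rplus_lt_le_0_compat; [apply mono_gt0; lra | unfold mono; lra].
- rewrite (Hloc (fun x => mono xi (sign sigma) 0 0 (sigma / xi) x b))
    by (intros x Hx; symmetry; now apply Fxs_mono).
  rewrite (is_derive_unique _ _ _ (is_derive_mono_a _ _ _ _ _ _ _ Ha)).
  apply Rplus_le_lt_0_compat; [unfold mono; lra | apply mono_gt0].
  now replace (sigma / xi * xi) with sigma by (field; auto).
Qed.

Lemma Fxs_incr_b xi sigma : sigma <> 0 ->
  forall a b, 0 < a -> 0 < b -> 0 < Db (Fxs xi sigma) a b.
Proof.
intros Hs a b Ha Hb.
replace (Db (Fxs xi sigma) a b) with (Da (Fxs xi sigma) b a).
- now apply Fxs_incr_a.
- unfold Da, Db; apply Derive_ext; intros y; unfold Fxs.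
  destruct (Req_EM_T xi 0).
  + now rewrite (Rmult_comm y).
  + now rewrite (Rplus_comm (Rpower y xi)).
Qed.

Definition Fxs_nv (xi sigma : R) (hs : sigma <> 0) : normal_velocity :=
  NormalVelocity (Fxs xi sigma) sigma (Fxs_sym xi sigma) (Fxs_C2 xi sigma) hs
    (Fxs_hom xi sigma) (Fxs_incr_a xi sigma hs) (Fxs_incr_b xi sigma hs).

Lemma Fxs_contracting xi sigma (hs : sigma <> 0) :
  0 < sigma -> contracting (Fxs_nv xi sigma hs).
Proof.
intros H a b _ _; simpl; unfold Fxs; rewrite (sign_eq_1 _ H), !Rmult_1_l.
destruct (Req_EM_T xi 0); apply Rpower_gt0.
Qed.

Lemma Fxs_expanding xi sigma (hs : sigma <> 0) :
  sigma < 0 -> expanding (Fxs_nv xi sigma hs).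
Proof.
intros H a b _ _; simpl; unfold Fxs; rewrite (sign_eq_m1 _ H).
assert (H1 := Rpower_gt0 (a * b) (sigma / 2)).
assert (H2 := Rpower_gt0 (Rpower a xi + Rpower b xi) (sigma / xi)).
destruct (Req_EM_T xi 0); lra.
Qed.

(* Main.v *)
(* Near the boundary point (0, 1), the velocity F behaves to second order like
   k a^p b^q with p + q = sigma, where p is 0, sigma/2 or sigma according as
   xi > 0, xi = 0 or xi < 0. By homogeneity, C, E and G at (rho, 1), divided by
   w_b > 0, involve w only through alpha and alpha_a. Suitably rescaled, they
   have limits as rho -> 0 once the asymptotics (5) are inserted.

   Contracting, alpha ~ c/rho: C <= 0 gives p + q c >= 1, while G <= 0 gives
   (p + q c)(p + q c - 1) <= 0; hence p + q c = 1.
   Contracting, alpha = c: C <= 0 gives p >= 1 and G <= 0 gives p (p - 1) <= 0;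
   hence p = 1.
   Expanding, alpha ~ c/rho: E <= 0 gives (p + q c)(p + q c + c) <= 0; hence
   p + q c + c >= 0, as p + q c < 0.
   Expanding, alpha ~ c/rho^2: E <= 0 gives q (q + 1) <= 0; hence q >= -1. *)

Require Import Defs.
From Stdlib Require Import Reals Lra.
From Coquelicot Require Import Coquelicot.

Open Scope R_scope.

(** * Homogeneous functions and Euler's relation on the line [b = 1] *)

Lemma is_derive_val (f : R -> R) x l l' :
  is_derive f x l -> l = l' -> is_derive f x l'.
Proof. now intros H <-. Qed.

Lemma is_derive_ext_pos (f g : R -> R) x l : 0 < x ->
  (forall t, 0 < t -> f t = g t) -> is_derive f x l -> is_derive g x l.
Proof.
intros Hx He; apply is_derive_ext_loc.
exists (mkposreal x Hx); intros t Ht; apply He.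
apply Rabs_def2 in Ht; unfold minus, plus, opp in Ht; simpl in Ht; lra.
Qed.

Section Homogeneous.

Variables (f : R -> R -> R) (m : R).
Hypothesis Hf : homogeneous f m.

Lemma homogeneous_slice a b : 0 < a -> 0 < b ->
  f a b = Rpower b m * f (a / b) 1.
Proof.
intros Ha Hb; rewrite <- Hf; auto using Rlt_0_1, Rdiv_lt_0_compat.
f_equal; field; lra.
Qed.

Lemma slice_homogeneous (h : R -> R -> R) (n : R) :
  (forall a b, 0 < a -> 0 < b -> h a b = Rpower b n * h (a / b) 1) ->
  homogeneous h n.
Proof.
intros Hh l a b Hl Ha Hb.
rewrite (Hh (l * a)), (Hh a); auto using Rmult_lt_0_compat.
rewrite <- Rpower_mult_distr; auto.
replace (l * a / (l * b)) with (a / b) by (field; lra); ring.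
Qed.

Lemma Rpower_pred b : 0 < b -> Rpower b m = Rpower b (m - 1) * b.
Proof.
intros Hb; rewrite <- (Rpower_1 b) at 3; auto.
rewrite <- Rpower_plus; f_equal; ring.
Qed.

Lemma is_derive_homogeneous_a a b l : 0 < a -> 0 < b ->
  is_derive (fun s => f s 1) (a / b) l ->
  is_derive (fun x => f x b) a (Rpower b (m - 1) * l).
Proof.
intros Ha Hb Hl.
apply is_derive_ext_pos with (fun x => Rpower b m * f (x / b) 1); auto.
{ intros t Ht; now rewrite <- homogeneous_slice. }
eapply is_derive_val.
- apply is_derive_scal, (is_derive_comp (fun s => f s 1)); [exact Hl|].
  auto_derive; [lra | reflexivity].
- unfold scal; simpl; unfold mult; simpl.
  rewrite (Rpower_pred b Hb); field; lra.
Qed.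

(** Product rule on [b^m f(a / b, 1)], so that only the one-variable slice is differentiated. *)
Lemma is_derive_homogeneous_b a b l : 0 < a -> 0 < b ->
  is_derive (fun s => f s 1) (a / b) l ->
  is_derive (fun y => f a y) b
    (Rpower b (m - 1) * (m * f (a / b) 1 - a / b * l)).
Proof.
intros Ha Hb Hl.
apply is_derive_ext_pos with (fun y => Rpower y m * f (a / y) 1); auto.
{ intros t Ht; now rewrite <- homogeneous_slice. }
eapply is_derive_val.
- apply (is_derive_mult (fun y => Rpower y m) (fun y => f (a / y) 1)).
  + now apply is_derive_Rpower.
  + apply (is_derive_comp (fun s => f s 1)); [exact Hl|].
    auto_derive; [lra | reflexivity].
  + exact Rmult_comm.
- unfold scal, plus, mult; simpl; unfold mult; simpl.
  rewrite (Rpower_pred b Hb); field; lra.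
Qed.

Hypothesis Df : forall s, 0 < s -> ex_derive (fun s => f s 1) s.

Lemma homogeneous_Da : homogeneous (Da f) (m - 1).
Proof.
apply slice_homogeneous; intros a b Ha Hb.
apply is_derive_unique, is_derive_homogeneous_a; auto.
apply Derive_correct, Df, Rdiv_lt_0_compat; auto.
Qed.

Lemma Db_homogeneous a b : 0 < a -> 0 < b ->
  Db f a b = Rpower b (m - 1) * (m * f (a / b) 1 - a / b * Da f (a / b) 1).
Proof.
intros Ha Hb; apply is_derive_unique, is_derive_homogeneous_b; auto.
apply Derive_correct, Df, Rdiv_lt_0_compat; auto.
Qed.

Lemma Rpower_1_l p : Rpower 1 p = 1.
Proof. unfold Rpower; rewrite ln_1, Rmult_0_r; apply exp_0. Qed.

(** Euler's relation [a f_a + b f_b = m f], solved for [f_b] at [b = 1]. *)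
Lemma Db_homogeneous_1 s : 0 < s -> Db f s 1 = m * f s 1 - s * Da f s 1.
Proof.
intros Hs; rewrite Db_homogeneous; auto using Rlt_0_1.
rewrite Rpower_1_l, Rdiv_1_r; ring.
Qed.

Lemma homogeneous_Db : homogeneous (Db f) (m - 1).
Proof.
apply slice_homogeneous; intros a b Ha Hb.
rewrite Db_homogeneous, Db_homogeneous_1; auto using Rdiv_lt_0_compat.
Qed.

End Homogeneous.

Section SecondOrder.

Variables (f : R -> R -> R) (m : R).
Hypothesis Hf : homogeneous f m.
Hypothesis Cf : C2 f.

Lemma C2_ex_derive s : 0 < s -> ex_derive (fun s => f s 1) s.
Proof. intros Hs; apply (Cf s 1 Hs Rlt_0_1). Qed.

Lemma C2_ex_derive_Da s : 0 < s -> ex_derive (fun s => Da f s 1) s.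
Proof.
intros Hs; destruct (Cf s 1 Hs Rlt_0_1) as (_ & _ & _ & H & _); apply H.
Qed.

(** Euler's relation differentiated along [b = 1]. This is the mixed derivative [Da (Db f)], which
    enters [Dbb]; [Dab] comes from Euler's relation for [Da f]. *)
Lemma is_derive_Db_1 s : 0 < s ->
  is_derive (fun s => Db f s 1) s ((m - 1) * Da f s 1 - s * Daa f s 1).
Proof.
intros Hs.
apply is_derive_ext_pos with (fun s => m * f s 1 - s * Da f s 1); auto.
{ intros t Ht; symmetry; apply Db_homogeneous_1; auto using C2_ex_derive. }
eapply is_derive_val.
- apply (is_derive_minus (V := R_NormedModule)).
  + apply is_derive_scal, Derive_correct, C2_ex_derive, Hs.
  + apply (is_derive_mult (fun s => s) (fun s => Da f s 1)).
    * apply (is_derive_id (K := R_AbsRing)).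
    * apply Derive_correct, C2_ex_derive_Da, Hs.
    * exact Rmult_comm.
- unfold Daa, Da, minus, plus, opp, mult, one; simpl; unfold mult; simpl; ring.
Qed.

Lemma Dab_homogeneous_1 s : 0 < s ->
  Dab f s 1 = (m - 1) * Da f s 1 - s * Daa f s 1.
Proof.
intros Hs; unfold Dab.
rewrite (Db_homogeneous_1 (Da f) (m - 1)); auto using C2_ex_derive_Da.
apply homogeneous_Da; auto using C2_ex_derive.
Qed.

Lemma Dbb_homogeneous_1 s : 0 < s ->
  Dbb f s 1 =
    m * (m - 1) * f s 1 - 2 * (m - 1) * s * Da f s 1 + s ^ 2 * Daa f s 1.
Proof.
intros Hs; unfold Dbb.
rewrite (Db_homogeneous_1 (Db f) (m - 1)); auto.
- rewrite (Db_homogeneous_1 f m); auto using C2_ex_derive.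
  assert (E := is_derive_unique _ _ _ (is_derive_Db_1 s Hs)).
  change (Derive _ s) with (Da (Db f) s 1) in E; rewrite E; ring.
- apply homogeneous_Db; auto using C2_ex_derive.
- intros t Ht; eexists; now apply is_derive_Db_1.
Qed.

(* [alpha f] has degree 0, so its [b]-derivative is [- s] times its
   [a]-derivative; this removes the Hessian of [f] in favour of the latter. *)
Lemma hess_alpha s : 0 < s -> Db f s 1 <> 0 ->
  hess f s 1 (alpha f s 1) =
    - (Db f s 1 * Da (alpha f) s 1 * (1 - alpha f s 1 * s)).
Proof.
intros Hs Hb.
assert (H : Da (alpha f) s 1 =
  - ((Daa f s 1 * Db f s 1
      - ((m - 1) * Da f s 1 - s * Daa f s 1) * Da f s 1) / Db f s 1 ^ 2)).
{ apply is_derive_unique; unfold alpha.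
  apply (is_derive_opp (V := R_NormedModule)).
  eapply is_derive_val.
  - apply (is_derive_div (fun s => Da f s 1) (fun s => Db f s 1)).
    + apply Derive_correct, C2_ex_derive_Da, Hs.
    + now apply is_derive_Db_1.
    + exact Hb.
  - unfold Daa, Da; match goal with |- @eq _ ?x ?y => change (@eq R x y) end; field; exact Hb. }
(* Reducing everything to [f], [Da f] and [Daa f] at [(s, 1)] leaves a rational identity with
   denominator [Db f]. *)
rewrite H; unfold hess, alpha.
rewrite Dab_homogeneous_1, Dbb_homogeneous_1; auto.
revert Hb; rewrite (Db_homogeneous_1 f m); auto using C2_ex_derive.
intros Hb; field; exact Hb.
Qed.

End SecondOrder.

(** * The inequalities of condition (4) at [(r, 1)] in scale-free form *)

Lemma Db_symmetric f a b : symmetric f -> 0 < a -> 0 < b -> Db f a b = Da f b a.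
Proof.
intros Hs Ha Hb; apply Derive_ext_loc.
exists (mkposreal b Hb); intros t Ht; apply Hs; auto.
apply Rabs_def2 in Ht; unfold minus, plus, opp in Ht; simpl in Ht; lra.
Qed.

(** Scale-free forms of [F_a] and [F_aa]: for [a^p b^q] they are the constants [p] and
    [p (p - 1)]. *)
Definition rel1 (F : R -> R -> R) (r : R) : R := r * Da F r 1 / F r 1.
Definition rel2 (F : R -> R -> R) (r : R) : R := r ^ 2 * Daa F r 1 / F r 1.

(* By Euler's relation, the Hessian of [F] in the direction [(1, al)] at
   [(r, 1)], times [r ^ 2 / F], with [P = rel1 F r], [A = rel2 F r], [t = al * r]. *)
Definition quad (s P A t : R) : R :=
  A + 2 * ((s - 1) * P - A) * t + (s * (s - 1) - 2 * (s - 1) * P + A) * t ^ 2.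

Lemma hess_quad f m r t : homogeneous f m -> C2 f -> 0 < r -> f r 1 <> 0 ->
  hess f r 1 t = f r 1 / r ^ 2 * quad m (rel1 f r) (rel2 f r) (t * r).
Proof.
intros Hf Cf Hr H0; unfold hess, quad, rel1, rel2.
rewrite (Dab_homogeneous_1 f m), (Dbb_homogeneous_1 f m); auto.
field; lra.
Qed.

Lemma Rmult_le_0_inv x y : 0 < x -> x * y <= 0 -> y <= 0.
Proof. intros Hx H; apply Rmult_le_reg_l with x; lra. Qed.

Section Inequalities.

Variables (F : normal_velocity) (w : R -> R -> R).
Hypothesis Hw : is_MPF F w.
Variable r : R.
Hypothesis Hr : 0 < r < 1.
Hypothesis HF : F r 1 <> 0.

Local Notation s := (nv_deg F).
Local Notation P := (rel1 F r).
Local Notation A := (rel2 F r).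
Local Notation t := (alpha w r 1 * r).
Local Notation v := (Da (alpha w) r 1 * r ^ 2).

(** By symmetry this is [w_a] at [(1, r)], positive by condition (3). *)
Lemma MPF_Db_pos : 0 < Db w r 1.
Proof.
rewrite Db_symmetric; [apply (mpf_incr F w) | apply (mpf_sym F w) | |]; auto; lra.
Qed.

Lemma MPF_Da : Da w r 1 = - alpha w r 1 * Db w r 1.
Proof. assert (H := MPF_Db_pos); unfold alpha; field; lra. Qed.

Lemma MPF_alpha_pos : 0 < alpha w r 1.
Proof.
assert (H := MPF_Db_pos).
assert (H1 := mpf_decr F w Hw r 1 (proj1 Hr) (proj2 Hr)).
rewrite MPF_Da in H1.
apply Rmult_lt_reg_r with (Db w r 1); lra.
Qed.

Lemma MPF_hess :
  hess w r 1 (alpha w r 1) = - (Db w r 1 * Da (alpha w) r 1 * (1 - t)).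
Proof.
assert (H := MPF_Db_pos).
destruct (mpf_hom F w Hw) as (chi & _ & Hh & _).
apply (hess_alpha w chi); auto; [apply (mpf_C2 F w Hw) | lra | lra].
Qed.

Lemma velocity_Da : Da F r 1 = F r 1 * P / r.
Proof. unfold rel1; field; lra. Qed.

Lemma velocity_Db : Db F r 1 = F r 1 * (s - P).
Proof.
rewrite (Db_homogeneous_1 F s).
- rewrite velocity_Da; field; lra.
- apply nv_hom.
- intros u Hu; apply C2_ex_derive; auto; apply nv_C2.
- lra.
Qed.

Lemma velocity_hess :
  hess F r 1 (alpha w r 1) = F r 1 / r ^ 2 * quad s P A t.
Proof.
apply (hess_quad F s); auto; [apply nv_hom | apply nv_C2 | lra].
Qed.

(** [C_term] divided by [w_b]. *)
Lemma C_term_le0 :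
  F r 1 * (1 - P * (1 - r) - t * ((s - P) * (1 - r) + r)) <= 0.
Proof.
assert (Hb := MPF_Db_pos).
apply Rmult_le_0_inv with (Db w r 1); auto.
assert (H := mpf_C F w Hw r 1 (proj1 Hr) Rlt_0_1).
unfold C_term in H; rewrite MPF_Da, velocity_Da, velocity_Db in H.
eapply Rle_trans; [|exact H]; right; field; lra.
Qed.

(** [E_term] times [r^3 (1 - r) / w_b]: the powers of [r] turn [alpha] and its derivative into [t]
    and [v], which converge when [alpha] has a simple pole, and [1 - r] clears the denominator
    [a - b]. *)
Lemma E_term_le0 :
  F r 1 * ((1 - r) * (- (t * quad s P A t) + P * v * (1 - t))
           - 2 * (P + t * (s - P)) * t ^ 2) <= 0.
Proof.
assert (Hb := MPF_Db_pos).
apply Rmult_le_0_inv with (Db w r 1 * / (r ^ 3 * (1 - r))).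
{ apply Rmult_lt_0_compat; auto; apply Rinv_0_lt_compat.
  apply Rmult_lt_0_compat; [apply pow_lt|]; lra. }
assert (H := mpf_E F w Hw r 1 (proj1 Hr) Rlt_0_1 (Rlt_not_eq _ _ (proj2 Hr))).
unfold E_term in H; cbv zeta in H.
rewrite MPF_hess, velocity_hess, MPF_Da, velocity_Da, velocity_Db in H.
eapply Rle_trans; [|exact H]; right.
generalize (quad s P A t); intros q; field; lra.
Qed.

(** [G_term] times [alpha^2 r^2 (1 - r) / w_b], a factor positive by [MPF_Db_pos] and
    [MPF_alpha_pos]. *)
Lemma G_term_le0 :
  F r 1 * ((1 - r) * (quad s P A t + (s - P) * v * (1 - t))
           - 2 * r * (P + t * (s - P))) <= 0.
Proof.
assert (Hb := MPF_Db_pos); assert (Ha := MPF_alpha_pos).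
apply Rmult_le_0_inv with
  (Db w r 1 * / ((alpha w r 1) ^ 2 * r ^ 2 * (1 - r))).
{ apply Rmult_lt_0_compat; auto; apply Rinv_0_lt_compat.
  repeat apply Rmult_lt_0_compat; lra. }
assert (H := mpf_G F w Hw r 1 (proj1 Hr) Rlt_0_1 (Rlt_not_eq _ _ (proj2 Hr))).
unfold G_term in H; cbv zeta in H.
rewrite MPF_hess, velocity_hess, MPF_Da, velocity_Da, velocity_Db in H.
eapply Rle_trans; [|exact H]; right.
generalize (quad s P A t); intros q; field; lra.
Qed.

End Inequalities.

(** * Limits from the right at 0 and the asymptotics (5) *)

Definition tends (f : R -> R) (l : R) : Prop :=
  filterlim f (at_right 0) (locally l).

Lemma at_right_0_1 (Q : R -> Prop) :
  (forall r, 0 < r < 1 -> Q r) -> at_right 0 Q.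
Proof.
intros H; exists (mkposreal 1 Rlt_0_1); intros r Hr H0.
apply Rabs_def2 in Hr; unfold minus, plus, opp in Hr; simpl in Hr.
apply H; lra.
Qed.

Lemma tends_ext f g l : at_right 0 (fun r => f r = g r) ->
  tends f l -> tends g l.
Proof. apply filterlim_ext_loc. Qed.

Lemma tends_const c : tends (fun _ => c) c.
Proof. apply filterlim_const. Qed.

Lemma tends_id : tends (fun r => r) 0.
Proof. intros Q [d Hd]; exists d; intros r Hr _; now apply Hd. Qed.

Lemma tends_plus f g lf lg :
  tends f lf -> tends g lg -> tends (fun r => f r + g r) (lf + lg).
Proof.
intros Hf Hg; apply (filterlim_comp_2 _ _ _ Hf Hg).
apply (filterlim_plus (V := R_NormedModule)).
Qed.

Lemma tends_mult f g lf lg :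
  tends f lf -> tends g lg -> tends (fun r => f r * g r) (lf * lg).
Proof.
intros Hf Hg; apply (filterlim_comp_2 _ _ _ Hf Hg).
apply (filterlim_mult (K := R_AbsRing)).
Qed.

Lemma tends_opp f l : tends f l -> tends (fun r => - f r) (- l).
Proof.
intros Hf; apply (filterlim_comp _ _ _ _ _ _ _ _ Hf).
apply (filterlim_opp (V := R_NormedModule)).
Qed.

Lemma tends_minus f g lf lg :
  tends f lf -> tends g lg -> tends (fun r => f r - g r) (lf - lg).
Proof. intros Hf Hg; apply tends_plus; auto using tends_opp. Qed.

Lemma tends_pow f l n : tends f l -> tends (fun r => f r ^ n) (l ^ n).
Proof.
intros Hf; induction n as [|n IH]; simpl; auto using tends_const, tends_mult.
Qed.

(** Computes a limit by recursion on the arithmetic expression; combined with [tends_eq], it leaves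
    only an algebraic identity for the limit value. The patterns [Rplus _], [Rminus _], [Rmult _]
    catch eta-reduced functions. *)
Ltac tends :=
  first [eassumption | lazymatch goal with
  | |- tends (fun r => _ + _) _ => apply tends_plus; tends
  | |- tends (fun r => _ - _) _ => apply tends_minus; tends
  | |- tends (fun r => _ * _) _ => apply tends_mult; tends
  | |- tends (fun r => - _) _ => apply tends_opp; tends
  | |- tends (fun r => _ ^ _) _ => apply tends_pow; tends
  | |- tends (fun r => r) _ => apply tends_id
  | |- tends (Rplus _) _ => apply tends_plus; tends
  | |- tends (Rminus _) _ => apply tends_minus; tends
  | |- tends (Rmult _) _ => apply tends_mult; tends
  | |- tends _ _ => apply tends_const
  end].

Lemma tends_eq f l l' : tends f l -> l = l' -> tends f l'.
Proof. now intros H <-. Qed.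

Lemma tends_le0 f l : (forall r, 0 < r < 1 -> f r <= 0) -> tends f l -> l <= 0.
Proof.
intros Hf Hl.
apply (filterlim_le (F := at_right 0) f (fun _ => 0) l 0); auto.
- now apply at_right_0_1.
- apply tends_const.
Qed.

Lemma o_inv_tends f : o_inv f -> tends (fun r => f r * r) 0.
Proof.
intros Hf; apply filterlim_locally; intros eps.
(* Domination gives a weak bound while the ball is open, hence half of [eps]. *)
assert (H := Hf (pos_div_2 eps)); simpl in H.
destruct H as [d Hd]; exists d; intros r Hr H0.
specialize (Hd r Hr H0).
unfold norm in Hd; simpl in Hd; unfold abs in Hd; simpl in Hd.
rewrite (Rabs_pos_eq (/ r)) in Hd by (left; now apply Rinv_0_lt_compat).
unfold ball; simpl; unfold AbsRing_ball, abs, minus, plus, opp; simpl.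
rewrite Ropp_0, Rplus_0_r, Rabs_mult, (Rabs_pos_eq r) by lra.
apply Rle_lt_trans with (eps / 2 * / r * r).
- apply Rmult_le_compat_r; lra.
- rewrite Rmult_assoc, Rinv_l by lra; assert (H := cond_pos eps); lra.
Qed.

Lemma asym_const_tends w c : asym_const w c ->
  tends (fun r => alpha w r 1 * r) 0 /\
  tends (fun r => Da (alpha w) r 1 * r ^ 2) 0.
Proof.
intros H; split.
- apply tends_ext with (fun r => c * r).
  + refine (filter_imp _ _ _ H); now intros r [-> _].
  + eapply tends_eq; [tends | ring].
- apply tends_ext with (fun _ => 0).
  + refine (filter_imp _ _ _ H); intros r [_ ->]; ring.
  + tends.
Qed.

Lemma asym_pole1_tends w c : asym_pole1 w c ->
  tends (fun r => alpha w r 1 * r) c /\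
  tends (fun r => Da (alpha w) r 1 * r ^ 2) (- c).
Proof.
intros [H1 H2]; apply o_inv_tends in H1, H2; split.
- eapply tends_ext; [| eapply tends_eq].
  2: exact (tends_plus _ _ _ _ (tends_const c) H1).
  + apply at_right_0_1; intros r Hr; simpl; field; lra.
  + ring.
- eapply tends_ext; [| eapply tends_eq].
  2: exact (tends_plus _ _ _ _ (tends_const (- c)) (tends_mult _ _ _ _ tends_id H2)).
  + apply at_right_0_1; intros r Hr; simpl; field; lra.
  + ring.
Qed.

(** A double pole calls for one more power of [r] than in [asym_pole1_tends]. *)
Lemma asym_pole2_tends w c d : asym_pole2 w c d ->
  tends (fun r => alpha w r 1 * r ^ 2) c /\
  tends (fun r => Da (alpha w) r 1 * r ^ 3) (- 2 * c).
Proof.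
intros [H1 H2]; apply o_inv_tends in H1, H2; split.
- eapply tends_ext with (fun r => c + d * r + r *
    ((alpha w r 1 - (c + d * r) / r ^ 2) * r)).
  + apply at_right_0_1; intros r Hr; field; lra.
  + eapply tends_eq; [tends | ring].
- eapply tends_ext with (fun r => - (2 * c + d * r) + r ^ 2 *
    ((Da (alpha w) r 1 - - ((2 * c + d * r) / r ^ 3)) * r)).
  + apply at_right_0_1; intros r Hr; field; lra.
  + eapply tends_eq; [tends | ring].
Qed.

(** * Limiting inequalities for a velocity resembling [a^p b^q] *)

Section Limits.

Variables (F : normal_velocity) (w : R -> R -> R) (p c : R).
Hypothesis Hw : is_MPF F w.
Local Notation q := (nv_deg F - p).

(* For [a ^ p * b ^ q] these hold exactly, without passing to the limit. *)
Hypothesis H1 : tends (rel1 F) p.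
Hypothesis H2 : tends (rel2 F) (p * (p - 1)).

Lemma contracting_asym_const : contracting F -> asym_const w c -> p = 1.
Proof.
intros HF Hc; destruct (asym_const_tends w c Hc) as [Ht Hv].
assert (C : 1 - p <= 0).
{ eapply tends_le0; [|eapply tends_eq].
  - intros r Hr; assert (H := HF r 1 (proj1 Hr) Rlt_0_1).
    apply (Rmult_le_0_inv _ _ H), (C_term_le0 F w Hw); auto; lra.
  - tends.
  - ring. }
(* As [t] and [v] tend to 0, only the limit of [rel2 F] remains. *)
assert (G : p * (p - 1) <= 0).
{ eapply tends_le0; [|eapply tends_eq].
  - intros r Hr; assert (H := HF r 1 (proj1 Hr) Rlt_0_1).
    apply (Rmult_le_0_inv _ _ H), (G_term_le0 F w Hw); auto; lra.
  - unfold quad; tends.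
  - ring. }
nra.
Qed.

Lemma contracting_asym_pole1 :
  contracting F -> asym_pole1 w c -> p + q * c = 1.
Proof.
intros HF Hc; destruct (asym_pole1_tends w c Hc) as [Ht Hv].
assert (C : 1 - (p + q * c) <= 0).
{ eapply tends_le0; [|eapply tends_eq].
  - intros r Hr; assert (H := HF r 1 (proj1 Hr) Rlt_0_1).
    apply (Rmult_le_0_inv _ _ H), (C_term_le0 F w Hw); auto; lra.
  - tends.
  - ring. }
(* [quad] tends to [p (p - 1) + 2 p q c + q (q - 1) c^2], and the term in [v] adds [- q c (1 - c)];
   the sum factors. *)
assert (G : (p + q * c) * (p + q * c - 1) <= 0).
{ eapply tends_le0; [|eapply tends_eq].
  - intros r Hr; assert (H := HF r 1 (proj1 Hr) Rlt_0_1).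
    apply (Rmult_le_0_inv _ _ H), (G_term_le0 F w Hw); auto; lra.
  - unfold quad; tends.
  - ring. }
nra.
Qed.

Lemma expanding_asym_pole1 : expanding F -> 0 < c -> asym_pole1 w c ->
  p + q * c < 0 -> 0 <= p + q * c + c.
Proof.
intros HF c0 Hc Hneg; destruct (asym_pole1_tends w c Hc) as [Ht Hv].
assert (E : c * ((p + q * c) * (p + q * c + c)) <= 0).
{ eapply tends_le0; [|eapply tends_eq].
  - intros r Hr; assert (H := HF r 1 (proj1 Hr) Rlt_0_1).
    (* As [F < 0], it is the negative of the bracket in [E_term_le0] that is at most 0. *)
    apply Rmult_le_0_inv with (- F r 1); [lra|].
    eapply Rle_trans; [right | apply (E_term_le0 F w Hw r); auto; lra].
    rewrite Ropp_mult_distr_l_reverse, <- Ropp_mult_distr_r_reverse.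
    f_equal; apply Ropp_involutive.
  - unfold quad; tends.
  - ring. }
apply Rmult_le_0_inv in E; auto; nra.
Qed.

Lemma expanding_asym_pole2 d : expanding F -> 0 < c -> asym_pole2 w c d ->
  -1 <= q.
Proof.
intros HF c0 Hc; destruct (asym_pole2_tends w c d Hc) as [Ht Hv].
set (T := fun r => alpha w r 1 * r ^ 2) in *.
set (V := fun r => Da (alpha w) r 1 * r ^ 3) in *.
assert (E : c ^ 3 * (q * (q + 1)) <= 0).
(* This is [- r^3] times the bracket in [E_term_le0], with [t = T / r] and [v = V / r]. In the limit
   only terms cubic in [T] survive, giving [c^3 (q (q - 1) + 2 q)]. *)
{ apply tends_le0 with (fun r =>
    - ((1 - r) * (- (T r * (r ^ 2 * rel2 F r
           + 2 * ((nv_deg F - 1) * rel1 F r - rel2 F r) * T r * r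
           + (nv_deg F * (nv_deg F - 1) - 2 * (nv_deg F - 1) * rel1 F r
              + rel2 F r) * T r ^ 2))
         + r * (rel1 F r * V r * (r - T r)))
       - 2 * (rel1 F r * r + T r * (nv_deg F - rel1 F r)) * T r ^ 2)).
  - intros r Hr; assert (H := HF r 1 (proj1 Hr) Rlt_0_1).
    apply Rmult_le_0_inv with (- F r 1 / r ^ 3).
    { apply Rdiv_lt_0_compat; [lra | apply pow_lt; lra]. }
    eapply Rle_trans; [right | apply (E_term_le0 F w Hw r); auto; lra].
    unfold T, V, quad; field; lra.
  - eapply tends_eq; [tends | ring]. }
assert (0 < c ^ 3) by now apply pow_lt.
apply Rmult_le_0_inv in E; auto; nra.
Qed.

End Limits.

(** * Boundary behaviour of the velocities [Fxs] *)

(* [a F_a / F] equals [sigma] times this for every [xi], including [xi = 0],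
   where it is the constant [1 / 2]. *)
Definition share (xi r : R) : R := Rpower r xi / (Rpower r xi + 1).

Lemma tends_Rpower_0 e : 0 < e -> tends (fun r => Rpower r e) 0.
Proof.
intros He; unfold tends, Rpower.
apply (filterlim_comp _ _ _ (fun r => e * ln r) exp _ (Rbar_locally m_infty)).
- apply (filterlim_comp _ _ _ ln (Rmult e) _ (Rbar_locally m_infty)).
  + exact is_lim_ln_0.
  + intros Q [M HM]; exists (M / e); intros x Hx; apply HM.
    apply Rmult_lt_reg_r with (/ e); [now apply Rinv_0_lt_compat|].
    replace (e * x * / e) with x by (field; lra); exact Hx.
- exact is_lim_exp_m.
Qed.

Lemma tends_continuous f g l : continuous g l -> tends f l ->
  tends (fun r => g (f r)) (g l).
Proof. intros Hg Hf; exact (filterlim_comp _ _ _ _ _ _ _ _ Hf Hg). Qed.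

Lemma share_pos xi : 0 < xi -> tends (share xi) 0.
Proof.
intros Hxi; eapply tends_eq.
- apply (tends_continuous (fun r => Rpower r xi) (fun u => u / (u + 1)) 0).
  + apply (ex_derive_continuous (V := R_NormedModule)); auto_derive; lra.
  + now apply tends_Rpower_0.
- simpl; field.
Qed.

Lemma share_0 r : share 0 r = / 2.
Proof. unfold share, Rpower; rewrite Rmult_0_l, exp_0; field. Qed.

(** Reduces negative exponents to positive ones. *)
Lemma share_opp xi r : share xi r = 1 - share (- xi) r.
Proof.
unfold share; rewrite Rpower_Ropp; assert (H := Rpower_gt0 r xi).
field; lra.
Qed.

Lemma share_neg xi : xi < 0 -> tends (share xi) 1.
Proof.
intros Hxi; apply tends_ext with (fun r => 1 - share (- xi) r).
{ apply at_right_0_1; intros r _; symmetry; apply share_opp. }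
assert (H := share_pos (- xi) ltac:(lra)).
eapply tends_eq; [tends | ring].
Qed.

(** [share xi r] is the logistic function of [xi * ln r]. *)
Lemma is_derive_share xi r : 0 < r ->
  is_derive (share xi) r (xi * share xi r * (1 - share xi r) / r).
Proof.
intros Hr; unfold share, Rpower; assert (H := exp_pos (xi * ln r)).
auto_derive; [repeat split; lra | field; lra].
Qed.

Lemma is_derive_Fxs xi s r : 0 < r ->
  is_derive (fun a => Fxs xi s a 1) r (Fxs xi s r 1 * (s * share xi r / r)).
Proof.
intros Hr; unfold Fxs, share, Rpower.
destruct (Req_EM_T xi 0) as [->|Hxi].
- auto_derive; [lra|].
  rewrite Rmult_0_l, exp_0, Rmult_1_r; field; lra.
- assert (H := exp_pos (xi * ln r)).
  rewrite ln_1, Rmult_0_r, exp_0.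
  auto_derive; [lra | field; lra].
Qed.

Lemma Da_Fxs xi s r : 0 < r ->
  Da (Fxs xi s) r 1 = Fxs xi s r 1 * (s * share xi r / r).
Proof. intros Hr; now apply is_derive_unique, is_derive_Fxs. Qed.

Section Velocity.

Variables (xi s : R) (hs : s <> 0).

Lemma Fxs_neq0 r : Fxs xi s r 1 <> 0.
Proof.
destruct (Rdichotomy _ _ hs) as [H|H]; unfold Fxs;
  [rewrite (sign_eq_m1 _ H) | rewrite (sign_eq_1 _ H)];
  destruct (Req_EM_T xi 0); apply Rmult_integral_contrapositive_currified;
  try lra; apply Rgt_not_eq, Rpower_gt0.
Qed.

Lemma rel1_Fxs r : 0 < r -> rel1 (Fxs xi s) r = s * share xi r.
Proof.
intros Hr; unfold rel1; rewrite Da_Fxs by exact Hr.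
assert (H := Fxs_neq0 r); field; lra.
Qed.

(** With [P = rel1], differentiating [F_a = F P / r] gives [r^2 F_aa / F = P (P - 1) + r P']; the
    last summand is [r P']. *)
Lemma rel2_Fxs r : 0 < r ->
  rel2 (Fxs xi s) r = s * share xi r * (s * share xi r - 1)
                      + s * (xi * share xi r * (1 - share xi r)).
Proof.
intros Hr.
assert (D : Daa (Fxs xi s) r 1 =
  Fxs xi s r 1 * (s * share xi r / r) * (s * share xi r / r)
  + Fxs xi s r 1
    * (s * ((xi * share xi r * (1 - share xi r) / r) * / r
            - share xi r / r ^ 2))).
{ apply is_derive_unique.
  apply is_derive_ext_pos with
    (fun r => Fxs xi s r 1 * (s * share xi r * / r)); auto.
  { intros t Ht; symmetry; now apply Da_Fxs. }
  eapply is_derive_val.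
  - apply (is_derive_mult (fun r => Fxs xi s r 1)); [| | exact Rmult_comm].
    + now apply is_derive_Fxs.
    + apply (is_derive_mult (fun r => s * share xi r) Rinv); [| | exact Rmult_comm].
      * now apply is_derive_scal, is_derive_share.
      * apply (is_derive_inv (fun r => r)); [apply (is_derive_id (K := R_AbsRing)) | lra].
  - unfold plus, mult, one; simpl; unfold mult; simpl; field; lra. }
unfold rel2; rewrite D; assert (H := Fxs_neq0 r); field; lra.
Qed.

(** The hypothesis on [x] and [xi] makes the limit of the extra summand in [rel2_Fxs] vanish,
    leaving the values of a pure monomial with [p = s x]. *)
Lemma rel_Fxs_tends x : x * (1 - x) = 0 \/ xi = 0 -> tends (share xi) x ->
  tends (rel1 (Fxs xi s)) (s * x) /\
  tends (rel2 (Fxs xi s)) (s * x * (s * x - 1)).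
Proof.
intros H Hx; split.
- apply tends_ext with (fun r => s * share xi r).
  + apply at_right_0_1; intros r Hr; symmetry; now apply rel1_Fxs.
  + tends.
- eapply tends_ext; [| eapply tends_eq].
  + apply at_right_0_1; intros r Hr; symmetry; now apply rel2_Fxs.
  + tends.
  + replace (xi * x * (1 - x)) with 0; [ring|].
    destruct H as [H| ->]; [rewrite Rmult_assoc, H|]; ring.
Qed.

End Velocity.

(** * Consequences for [sigma], [xi] and [c] *)

(** The two alternatives are the two branches of (5), with [p = s x] and [q = s (1 - x)]. *)
Lemma Fxs_contracting_asymptotics xi s (hs : s <> 0) w x c d :
  0 < s -> x * (1 - x) = 0 \/ xi = 0 -> tends (share xi) x ->
  is_MPF (Fxs_nv xi s hs) w -> MPF_asymptotics (Fxs_nv xi s hs) w c d ->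
  s * x = 1 \/ s * (x + (1 - x) * c) = 1.
Proof.
intros Hs Hx Lx Hw [Hc _]; destruct (rel_Fxs_tends xi s hs x Hx Lx) as [H1 H2].
assert (HF := Fxs_contracting xi s hs Hs).
destruct (Hc HF) as [H|H]; [left | right].
- exact (contracting_asym_const (Fxs_nv xi s hs) w _ c Hw H1 H2 HF H).
- assert (E := contracting_asym_pole1 (Fxs_nv xi s hs) w _ c Hw H1 H2 HF H).
  simpl in E; lra.
Qed.

Lemma Fxs_expanding_asymptotics xi s (hs : s <> 0) w x :
  s < 0 -> 0 <= x < 1 -> x * (1 - x) = 0 \/ xi = 0 -> tends (share xi) x ->
  is_MPF (Fxs_nv xi s hs) w -> -1 <= s * (1 - x).
Proof.
intros Hs Bx Hx Lx Hw; destruct (rel_Fxs_tends xi s hs x Hx Lx) as [H1 H2].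
assert (HF := Fxs_expanding xi s hs Hs).
destruct (mpf_asym _ _ Hw) as (c & d & c0 & _ & He).
replace (s * (1 - x)) with (nv_deg (Fxs_nv xi s hs) - s * x) by (simpl; ring).
destruct (He HF) as [H|H].
- assert (E := expanding_asym_pole1 (Fxs_nv xi s hs) w _ c Hw H1 H2 HF c0 H).
  simpl in E |- *.
  (* Since [p = s x <= 0], the bound [p + q c + c >= 0] yields [c (1 + q) >= 0]. Its premise
     [p + q c < 0] holds because [x < 1] makes [q] negative. *)
  apply Rplus_le_reg_l with 1, Rmult_le_reg_l with c; auto.
  assert (s * x <= 0) by nra.
  assert (s * (1 - x) < 0) by nra.
  assert (s * (1 - x) * c < 0) by nra.
  specialize (E ltac:(lra)); lra.
- exact (expanding_asym_pole2 (Fxs_nv xi s hs) w _ c Hw H1 H2 d HF c0 H).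
Qed.

Theorem theorem5p8 (xi sigma : R) (hs : sigma <> 0) :
  (1 < sigma ->
     (0 < xi -> forall w : R -> R -> R, is_MPF (Fxs_nv xi sigma hs) w ->
        forall c d : R, 0 < c -> MPF_asymptotics (Fxs_nv xi sigma hs) w c d ->
          c = 1 / sigma) /\
     (xi = 0 -> forall w : R -> R -> R, is_MPF (Fxs_nv xi sigma hs) w ->
        1 < sigma <= 2) /\
     (xi < 0 -> ~ exists w : R -> R -> R, is_MPF (Fxs_nv xi sigma hs) w)) /\
  (sigma < 0 ->
     (0 < xi -> forall w : R -> R -> R, is_MPF (Fxs_nv xi sigma hs) w ->
        -1 <= sigma < 0) /\
     (xi = 0 -> forall w : R -> R -> R, is_MPF (Fxs_nv xi sigma hs) w ->
        -2 <= sigma < 0)).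
Proof.
assert (L0 : xi = 0 -> tends (share xi) (/ 2)).
{ intros ->; apply tends_ext with (fun _ => / 2); [|apply tends_const].
  apply at_right_0_1; intros r _; symmetry; apply share_0. }
split; intros Hs; [assert (s0 : 0 < sigma) by lra|].
- split; [|split].
  + intros Hxi w Hw c d c0 Hc.
    assert (Hx : 0 * (1 - 0) = 0 \/ xi = 0) by (left; ring).
    (* With [x = 0] the alternatives read [0 = 1] and [sigma c = 1]. *)
    destruct (Fxs_contracting_asymptotics xi sigma hs w 0 c d s0 Hx
                (share_pos xi Hxi) Hw Hc) as [H|H]; [lra|].
    apply Rmult_eq_reg_l with sigma; auto; field_simplify; auto; lra.
  + intros Hxi w Hw; split; auto.
    destruct (mpf_asym _ _ Hw) as (c & d & c0 & Hc).
    (* With [x = 1/2] either [sigma = 2] or [sigma (1 + c) = 2], and [c > 0]. *)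
    destruct (Fxs_contracting_asymptotics xi sigma hs w (/ 2) c d s0
                (or_intror Hxi) (L0 Hxi) Hw Hc) as [H|H]; [lra|].
    assert (0 < sigma * c) by now apply Rmult_lt_0_compat.
    lra.
  + intros Hxi [w Hw].
    destruct (mpf_asym _ _ Hw) as (c & d & c0 & Hc).
    assert (Hx : 1 * (1 - 1) = 0 \/ xi = 0) by (left; ring).
    (* With [x = 1] both alternatives force [sigma = 1]. *)
    destruct (Fxs_contracting_asymptotics xi sigma hs w 1 c d s0 Hx
                (share_neg xi Hxi) Hw Hc); lra.
- split; intros Hxi w Hw; split; auto.
  + assert (Hx : 0 * (1 - 0) = 0 \/ xi = 0) by (left; ring).
    assert (H := Fxs_expanding_asymptotics xi sigma hs w 0 Hs ltac:(lra) Hx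
                   (share_pos xi Hxi) Hw); lra.
  + assert (H := Fxs_expanding_asymptotics xi sigma hs w (/ 2) Hs ltac:(lra)
                   (or_intror Hxi) (L0 Hxi) Hw); lra.
Qed.
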